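(* Let $\Omega\subset\mathbb{R}^n$ be open and $I=(0,T)$, $T>0$. For $n\in\mathbb{N}$ let $F_n:\Omega\times I\times\mathbb{R}\times\mathbb{R}\times\mathbb{R}^n\times\operatorname{Sym}(n)\to\mathbb{R}$ (with $\operatorname{Sym}(n)$ referring to the space dimension) be a uniformly locally bounded sequence, let $G_n:\Omega\times I\times\mathbb{R}\times\mathbb{R}^n\to[0,\infty)$ be continuous functions converging uniformly to some $G$, and let $\mathcal{S}_n,\mathcal{S}:\mathbb{R}\to\mathcal{P}(\mathbb{R})\setminus\{\emptyset\}$ be such that whenever $a_n\to a$ and $\mu_n\in\mathcal{S}_n(a_n)$, there is a subsequence with $\mu_{n_k}\to\mu$ for some $\mu\in\mathcal{S}(a)$. Let $u_n\in USC(\Omega\times I)$ be viscosity subsolutions of $$F_n(x,t,u_n,(u_n)_t,\nabla u_n,D^2u_n)\in\mathcal{S}_n((u_n)_t)\,G_n(x,t,u_n,\nabla u_n)\quad\text{in }\Omega\times I.$$ If the functions $u_n$ are uniformly locally bounded on $\Omega\times I$, then $\overline u:=\operatorname{limsup}^*_{n\to\infty}u_n$ is a viscosity subsolution of $$\underline F(x,t,u,u_t,\nabla u,D^2u)\in\mathcal{S}(u_t)\,G(x,t,u,\nabla u)\quad\text{in }\Omega\times I,$$ where $\underline F:=\operatorname{liminf}_{*\,n\to\infty}F_n$. Likewise, if $u_n\in LSC(\Omega\times I)$ are viscosity supersolutions of the $n$-th inclusions and are uniformly locally bounded on $\Omega\times I$, then $\underline u:=\operatorname{liminf}_{*\,n\to\infty}u_n$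 is a viscosity supersolution of $\overline F(x,t,u,u_t,\nabla u,D^2u)\in\mathcal{S}(u_t)\,G(x,t,u,\nabla u)$ in $\Omega\times I$, where $\overline F:=\operatorname{limsup}^*_{n\to\infty}F_n$.
   Context: Half-relaxed limits: a sequence $g_n:A\to\mathbb{R}$ is uniformly locally bounded if $\sup_n\sup_{z\in K}|g_n(z)|<\infty$ for every compact $K\subset A$; then $\operatorname{limsup}^*_{n\to\infty}g_n(z):=\limsup_{n\to\infty,\,y\to z}g_n(y)$ and $\operatorname{liminf}_{*\,n\to\infty}g_n(z):=\liminf_{n\to\infty,\,y\to z}g_n(y)$ (for $F_n$, with respect to all variables jointly). $USC$ / $LSC$ denote real-valued upper-/lower-semicontinuous functions. Envelopes: $f^*(z)=\inf\{g(z): g\in USC,\ g\ge f\}$ and $f_*(z)=\sup\{g(z): g\in LSC,\ g\le f\}$. Parabolic jets: for $u\in USC(\Omega\times I)$, $\mathcal{P}^{2,+}u(\hat x,\hat t)$ is the set of $(a,p,X)$ (real number, vector, symmetric matrix) such that $$u(x,t)\le u(\hat x,\hat t)+a(t-\hat t)+\langle p,x-\hat x\rangle+\tfrac12\langle X(x-\hat x),x-\hat x\rangle+o(|t-\hat t|+|x-\hat x|^2)$$ as $(x,t)\to(\hat x,\hat t)$; for $v\in LSC(\Omega\times I)$, $\mathcal{P}^{2,-}v=-\mathcal{P}^{2,+}(-v)$. For an inclusion $F(x,t,u,u_t,\nabla u,D^2u)\in\mathcal{S}(u_t)G(x,t,u,\nabla u)$: a viscosity subsolution is $u\in USC(\Omega\times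 I)$ such that for every $(x,t)$ and $(a,p,X)\in\mathcal{P}^{2,+}u(x,t)$ there is $\mu\in\mathcal{S}(a)$ with $F_*(x,t,u(x,t),a,p,X)\le\mu\,G(x,t,u(x,t),p)$; a viscosity supersolution is $v\in LSC(\Omega\times I)$ such that for every $(x,t)$ and $(b,q,Y)\in\mathcal{P}^{2,-}v(x,t)$ there is $\nu\in\mathcal{S}(b)$ with $F^*(x,t,v(x,t),b,q,Y)\ge\nu\,G(x,t,v(x,t),q)$.
   Formalization: The condition on S_n and S is assumed along every subsequence: if a_k → a and μ_k ∈ S_{m(k)}(a_k) with m strictly increasing, then some subsequence of μ_k converges to a point of S(a); with full sequences only, the claim is false. *)

(* Defs.v *)
From HB Require Import structures.
From mathcomp Require Import all_boot all_order all_algebra.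
From mathcomp Require Import all_classical all_reals all_analysis.

Set Implicit Arguments.
Unset Strict Implicit.
Unset Printing Implicit Defensive.

Import Order.TTheory GRing.Theory Num.Theory.
Import numFieldNormedType.Exports.

Local Open Scope classical_set_scope.
Local Open Scope ring_scope.

(* A real function on a set A is represented by a total function; every notion
   below only depends on its restriction to A. *)

Section Semicontinuity.
Context {R : realType} {Z : topologicalType}.
Implicit Types (A : set Z) (f g : Z -> R).

(* In [subspace A] a point of A has its relative neighbourhoods and a point
   outside A is isolated, so that only points of A are constrained. *)
Definition lsc_on A f :=
  lower_semicontinuous (EFin \o f : subspace A -> \bar R).

Definition usc_on A f := lsc_on A (\- f).

Definition usc_envelope A f (z : Z) : R :=
  inf [set g z | g in [set g | usc_on A g /\ forall y, A y -> f y <= g y]].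

Definition lsc_envelope A f (z : Z) : R :=
  sup [set g z | g in [set g | lsc_on A g /\ forall y, A y -> g y <= f y]].

Definition unif_locally_bounded A (g_ : nat -> Z -> R) :=
  forall K : set Z, compact K -> K `<=` A ->
    exists M : R, forall n z, K z -> `|g_ n z| <= M.

(* The joint limits in (n, y), with n tending to infinity and y tending to z
   inside A (y = z allowed).  They are finite at the points of A when g_ is
   uniformly locally bounded on a locally compact A. *)
Definition hr_limsup A (g_ : nat -> Z -> R) (z : Z) : R :=
  fine (limf_esup (fun ny : nat * Z => (g_ ny.1 ny.2)%:E)
                  (filter_prod \oo (within A (nbhs z)))).

Definition hr_liminf A (g_ : nat -> Z -> R) (z : Z) : R :=
  fine (limf_einf (fun ny : nat * Z => (g_ ny.1 ny.2)%:E)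
                  (filter_prod \oo (within A (nbhs z)))).

End Semicontinuity.

Section Inclusions.
Context {R : realType} {d : nat}.

Local Notation V := 'cV[R]_d.
Local Notation M := 'M[R]_d.

Definition dotv (p q : V) : R := \sum_(i < d) p i 0 * q i 0.

Definition dom_u (Omega : set V) (I : set R) : set (V * R) := Omega `*` I.

Definition dom_G (Omega : set V) (I : set R) : set (V * R * R * V) :=
  [set z | dom_u Omega I z.1.1].

Definition dom_F (Omega : set V) (I : set R) : set (V * R * R * R * V * M) :=
  [set z | dom_u Omega I z.1.1.1.1 /\ z.2^T = z.2].

(* r is the o(|t - t0| + |x - x0|^2) term, with the Euclidean norm on R^d *)
Definition superjet (D : set (V * R)) (u : V * R -> R) (z0 : V * R) :
    set (R * V * M) :=
  [set j | let: (a, p, X) := j in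
    X^T = X /\
    exists2 r : V * R -> R^o,
      r =o_ (within D (nbhs z0))
        (fun z => `|z.2 - z0.2| + dotv (z.1 - z0.1) (z.1 - z0.1) : R^o) &
      \forall z \near within D (nbhs z0),
        u z <= u z0 + a * (z.2 - z0.2) + dotv p (z.1 - z0.1)
               + 2^-1 * dotv (X *m (z.1 - z0.1)) (z.1 - z0.1) + r z].

Definition subjet (D : set (V * R)) (v : V * R -> R) (z0 : V * R) :
    set (R * V * M) :=
  [set - j | j in superjet D (\- v) z0].

Definition viscosity_subsolution (Omega : set V) (I : set R)
    (F : V * R * R * R * V * M -> R) (S : R -> set R)
    (G : V * R * R * V -> R) (u : V * R -> R) :=
  usc_on (dom_u Omega I) u /\
  forall x t a p X, Omega x -> I t ->
    superjet (dom_u Omega I) u (x, t) (a, p, X) ->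
    exists2 mu, S a mu &
      lsc_envelope (dom_F Omega I) F (x, t, u (x, t), a, p, X)
        <= mu * G (x, t, u (x, t), p).

Definition viscosity_supersolution (Omega : set V) (I : set R)
    (F : V * R * R * R * V * M -> R) (S : R -> set R)
    (G : V * R * R * V -> R) (v : V * R -> R) :=
  lsc_on (dom_u Omega I) v /\
  forall x t b q Y, Omega x -> I t ->
    subjet (dom_u Omega I) v (x, t) (b, q, Y) ->
    exists2 nu, S b nu &
      nu * G (x, t, v (x, t), q)
        <= usc_envelope (dom_F Omega I) F (x, t, v (x, t), b, q, Y).

End Inclusions.

(* The indices m n range over an arbitrary subsequence: for full sequences
   (m = id) only, the condition would say nothing about, e.g., the odd-indexed
   S_ n as soon as the even-indexed ones satisfy it. *)
Definition multimaps_converge {R : realType} (S_ : nat -> R -> set R)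
    (S : R -> set R) :=
  forall (m : nat -> nat) (a_ mu_ : nat -> R) (a : R),
    increasing_seq m -> a_ @ \oo --> a ->
    (forall n, S_ (m n) (a_ n) (mu_ n)) ->
    exists (k : nat -> nat) (mu : R),
      [/\ increasing_seq k, mu_ \o k @ \oo --> mu & S a mu].

(* Main.v *)
(* A jet of the half-relaxed limit u is a limit of jets of the u_n: if phi
   touches u strictly from above at z0, then u_n - phi has, for infinitely many
   n, a local maximum close to z0 with a value close to u(z0). Choosing mu_n in
   S_n(a_n) for these jets and extracting a convergent subsequence, the n-th
   inequalities pass to the limit, because the half-relaxed lower limit of the
   F_n bounds the lower limit of the F_n's lsc envelopes along convergent
   sequences. The sign of G plays no role in this argument, so supersolutions
   follow by applying it to -u_n, -F_n and -G_n with the same S_n. *)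
Require Import Defs.
From HB Require Import structures.
From mathcomp Require Import all_boot all_order all_algebra.
From mathcomp Require Import all_classical all_reals all_analysis.
From mathcomp Require Import ring lra.

Import Order.TTheory GRing.Theory Num.Theory.
Import numFieldNormedType.Exports.

Local Open Scope classical_set_scope.
Local Open Scope ring_scope.

(** * Semicontinuity and sequential compactness in terms of neighbourhoods *)

Lemma lsc_onP (R : realType) (Z : topologicalType) (A : set Z) (f : Z -> R) :
  lsc_on A f <-> forall z a, A z -> a < f z ->
    \forall y \near within A (nbhs z), a < f y.
Proof.
split=> [lf z a Az afz|lf z a].
  have [|V] := lf z a; first by rewrite lte_fin.
  rewrite (nbhs_subspace_in Az) => zV Va.
  by apply: filterS zV => y /Va; rewrite lte_fin.
(* At a point outside [A] every set containing the point is a neighbourhood in the subspace, so only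
   points of [A] call on the hypothesis. *)
have nbhs_lt (w : Z) : a < f w -> nbhs_subspace (A := A) w (fun y => a < f y).
  move=> afw; have [Aw|nAw] := pselect (A w).
    by rewrite -(nbhs_subspace_in Aw); exact: lf.
  by rewrite -(nbhs_subspace_out nAw) => _ ->.
rewrite lte_fin => /nbhs_lt azf.
by exists [set y | a < f y] => // y; rewrite /= lte_fin.
Qed.

Lemma usc_onP (R : realType) (Z : topologicalType) (A : set Z) (f : Z -> R) :
  usc_on A f <-> forall z a, A z -> f z < a ->
    \forall y \near within A (nbhs z), f y < a.
Proof.
rewrite /usc_on lsc_onP; split=> uf z a Az fza.
  have := uf z (- a) Az; rewrite /= ltrN2 => /(_ fza).
  by apply: filterS => y; rewrite ltrN2.
have := uf z (- a) Az; rewrite ltrNr => /(_ fza).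
by apply: filterS => y; rewrite /= ltrNr.
Qed.

(** Compactness is used as a near-covering property: what holds near [z] holds at all but finitely
    many [x k], and the remaining indices form a finite conjunction, built by induction on [N]. *)
Lemma compact_cvg_range (Z : topologicalType) (x : nat -> Z) (z : Z) :
  x @ \oo --> z -> compact (z |` range x).
Proof.
move=> xz; apply/compact_near_coveringP => I F P FF cov.
have [[U V] [/= zU FV] UVP] : \forall x' \near z & i \near F, P i x'.
  by apply: cov; left.
have [N _ NU] := xz _ zU.
have FN k : \forall i \near F, P i (x k).
  have [[U' V'] [/= zU' FV'] UVP'] : \forall x' \near x k & i \near F, P i x'.
    by apply: cov; right; exists k.
  by apply: filterS FV' => i V'i; apply: (UVP' (x k, i)); split => //;
     exact: nbhs_singleton.
have FNs : \forall i \near F, forall k, (k < N)%N -> P i (x k).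
  elim: {NU}N => [|N IH]; first exact: nearW.
  apply: filterS2 IH (FN N) => i Pi PiN k; rewrite ltnS leq_eqVlt.
  by move=> /predU1P[->//|]; exact: Pi.
apply: filterS2 FNs FV => i Pi Vi y [->|[k _ <-]].
  by apply: (UVP (z, i)); split => //; exact: nbhs_singleton.
have [kN|Nk] := ltnP k N; first exact: Pi.
by apply: (UVP (x k, i)); split => //; exact: NU.
Qed.

Lemma cvg_ball_inv (R : realType) (Z : pseudoMetricType R) (z_ : nat -> Z) z :
  (forall k, ball z k.+1%:R^-1 (z_ k)) -> z_ @ \oo --> z.
Proof.
move=> bz; apply/cvg_ballP => e e0; near=> k.
apply: le_ball (bz k); rewrite invf_ple ?posrE//.
near: k; exists (Num.truncn e^-1) => // k /= ek.
by apply/ltW; apply: lt_le_trans (truncnS_gt _) _; rewrite ler_nat ltnS.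
Unshelve. all: by end_near. Qed.

(** * Half-relaxed limits and semicontinuous envelopes *)

Section HalfRelaxed.
Context {R : realType} {Z : pseudoMetricType R}.
Implicit Types (A : set Z) (gs : nat -> Z -> R) (f g : Z -> R) (z : Z).

(* Otherwise gs is unbounded along a sequence of points of A converging to z,
   which together with z forms a compact subset of A. *)
Lemma unif_locally_bounded_near A gs z :
  unif_locally_bounded A gs -> A z ->
  exists M, \forall y \near within A (nbhs z), forall n, `|gs n y| <= M.
Proof.
move=> bg Az; apply: contrapT => nb.
have /choice[y yP] : forall k, exists y,
    [/\ A y, ball z k.+1%:R^-1 y & exists n, k%:R < `|gs n y|].
  move=> k; apply: contrapT => nP; apply: nb; exists k%:R.
  apply/nbhs_ballP; exists k.+1%:R^-1 => /=; first by rewrite invr_gt0.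
  move=> w zw Aw n; rewrite leNgt; apply/negP => kgw.
  by apply: nP; exists w; split => //; exists n.
have yz : y @ \oo --> z by apply: cvg_ball_inv => k; have [] := yP k.
have [|M MP] := bg _ (compact_cvg_range _ _ _ yz).
  by move=> w [->//|[k _ <-]]; have [] := yP k.
have [_ _ [n kn]] := yP (Num.truncn M).+1.
have := MP n (y (Num.truncn M).+1); rewrite leNgt => /(_ _)/negP; apply.
  by right; exists (Num.truncn M).+1.
by apply: lt_trans kn; apply: lt_le_trans (truncnS_gt _) _; rewrite ler_nat.
Qed.

Lemma within_nbhs_proper A z : A z -> ProperFilter (within A (nbhs z)).
Proof.
move=> Az; apply: Build_ProperFilter_ex => P /nbhs_singleton/(_ Az) Pz.
by exists z.
Qed.

(** The [fine] in [hr_limsup] loses nothing: a common bound [M] of all [gs n] near [z] keeps the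
    extended limit between [- M] and [M]. The lower estimate rests on the filter being proper. *)
Lemma hr_limsup_fin A gs z : unif_locally_bounded A gs -> A z ->
  limf_esup (fun ny : nat * Z => (gs ny.1 ny.2)%:E)
    (filter_prod \oo (within A (nbhs z))) = (hr_limsup A gs z)%:E.
Proof.
move=> bg Az; rewrite /hr_limsup fineK//.
have [M Mz] := unif_locally_bounded_near A gs z bg Az.
have Wz := within_nbhs_proper A z Az.
have FM : \forall n \near \oo & y \near within A (nbhs z), `|gs n y| <= M.
  exists (setT, [set y | forall n, `|gs n y| <= M]) => /=.
    by split => //; exact: filterT.
  by move=> [n y] [_ /=]; exact.
rewrite fin_real//; apply/andP; split; last first.
  apply: (@le_lt_trans _ _ M%:E); last by rewrite ltry.
  apply: ereal_inf_le; eexists; first by eexists; [exact: FM|reflexivity].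
  by apply: ge_ereal_sup => _ [[n y] /= gM <-]; rewrite lee_fin (le_trans (ler_norm _)).
apply: (@lt_le_trans _ _ (- M)%:E); first by rewrite ltNyr.
apply: le_ereal_inf_tmp => _ [V FV <-].
have [[n y] /= [Vny gM]] := filter_ex (filterI FV FM).
apply: le_trans (ereal_sup_ubound _); last by exists (n, y).
by rewrite lee_fin lerNl (le_trans (ler_norm _))// normrN.
Qed.

Lemma hr_limsup_lt A gs z c : unif_locally_bounded A gs -> A z ->
  hr_limsup A gs z < c ->
  \forall n \near \oo & y \near within A (nbhs z), gs n y < c.
Proof.
move=> bg Az; rewrite -lte_fin -hr_limsup_fin// => /ereal_inf_lt[_ [V FV <-]].
move=> Vc; apply: filterS FV => -[n y] Vny; rewrite -lte_fin.
by apply: le_lt_trans Vc; apply: ereal_sup_ubound; exists (n, y).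
Qed.

Lemma hr_limsup_le A gs z c : unif_locally_bounded A gs -> A z ->
  (\forall n \near \oo & y \near within A (nbhs z), gs n y <= c) ->
  hr_limsup A gs z <= c.
Proof.
move=> bg Az gc; rewrite -lee_fin -hr_limsup_fin//.
apply: ereal_inf_le; eexists; first by eexists; [exact: gc|reflexivity].
by apply: ge_ereal_sup => _ [[n y] /= + <-]; rewrite lee_fin.
Qed.

(** A bound on the [gs n] over a relative neighbourhood of [z] is, after passing to the interior, a
    bound over a relative neighbourhood of each nearby [y], hence a bound on the limit at [y]. The
    midpoint threshold keeps the conclusion strict. *)
Lemma usc_on_hr_limsup A gs : unif_locally_bounded A gs ->
  usc_on A (hr_limsup A gs).
Proof.
move=> bg; apply/usc_onP => z a Az za.
have [|[U V] [/= FU zV] UVg] := hr_limsup_lt A gs z ((hr_limsup A gs z + a) / 2) bg Az.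
  lra.
have : \forall y \near within A (nbhs z), A y /\ nbhs y (fun w => A w -> V w).
  rewrite near_withinE; have := zV; rewrite /within/= => /nbhs_interior.
  by apply: filterS => y.
apply: filterS => y [Ay yV]; apply: (@le_lt_trans _ _ ((hr_limsup A gs z + a) / 2)); last lra.
apply: hr_limsup_le => //; exists (U, V) => //= -[n w] ?.
by apply/ltW/(UVg (n, w)).
Qed.

Lemma unif_locally_boundedN A gs : unif_locally_bounded A gs ->
  unif_locally_bounded A (fun n => \- gs n).
Proof.
move=> bg K cK KA; have [M MP] := bg K cK KA.
by exists M => n z Kz; rewrite /= normrN MP.
Qed.

Lemma unif_locally_bounded_cst A gs n : unif_locally_bounded A gs ->
  unif_locally_bounded A (fun=> gs n).
Proof.
by move=> bg K cK KA; have [M MP] := bg K cK KA; exists M => _; exact: MP.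
Qed.

Lemma hr_liminfE A gs : hr_liminf A gs = \- hr_limsup A (fun n => \- gs n).
Proof. by apply/funext => z; rewrite /hr_liminf /limf_einf fineN. Qed.

Lemma hr_limsupE A gs : hr_limsup A gs = \- hr_liminf A (fun n => \- gs n).
Proof.
apply/funext => z; rewrite hr_liminfE /= opprK; congr (hr_limsup _ _ _).
by apply/funext => n; apply/funext => y /=; rewrite opprK.
Qed.

Lemma lsc_on_hr_liminf A gs : unif_locally_bounded A gs ->
  lsc_on A (hr_liminf A gs).
Proof. by move=> /unif_locally_boundedN/usc_on_hr_limsup; rewrite hr_liminfE. Qed.

(** The joint limit admits [y = z], so the constant sequence sees the value [f z] itself. *)
Lemma hr_liminf_cst_le A f z : unif_locally_bounded A (fun=> f) -> A z ->
  hr_liminf A (fun=> f) z <= f z.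
Proof.
move=> bf Az; rewrite hr_liminfE /= lerNl leNgt; apply/negP => lf.
have [[U V] [/= [n _ Un] zV] UV] :=
  hr_limsup_lt _ _ _ _ (unif_locally_boundedN _ _ bf) Az lf.
have /UV : (U `*` V) (n, z)
  by split; [apply: (Un n) => /=|exact: (nbhs_singleton zV)].
by rewrite /= ltxx.
Qed.

(** A [sup] dominates its members only when they are bounded above; at a point of [A] the value
    [f z] is such a bound. *)
Lemma lsc_envelope_ge A f g z : lsc_on A g -> (forall y, A y -> g y <= f y) ->
  A z -> g z <= lsc_envelope A f z.
Proof.
move=> lg gf Az; apply: ub_le_sup; last by exists g.
by exists (f z) => _ [h [_ hf] <-]; exact: hf.
Qed.

Lemma lsc_envelope_id A f z : lsc_on A f -> A z -> lsc_envelope A f z = f z.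
Proof.
move=> lf Az; apply/eqP; rewrite eq_le lsc_envelope_ge// andbT.
by apply: ge_sup; [exists (f z), f|move=> _ [h [_ hf] <-]; exact: hf].
Qed.

(** Since [inf] is by definition the opposite of a [sup], it is enough to match the two families of
    competitors through negation. *)
Lemma usc_envelopeE A f z : usc_envelope A f z = - lsc_envelope A (\- f) z.
Proof.
rewrite /usc_envelope /inf /lsc_envelope; congr (- sup _).
apply/seteqP; split=> [_ [_ [g [ug fg] <-] <-]|_ [g [lg gf] <-]].
  by exists (\- g) => //; split=> // y Ay; rewrite /= lerN2 fg.
exists (- g z); last by rewrite opprK.
exists (\- g) => //; split=> [|y Ay]; last by rewrite /= lerNr gf.
rewrite /usc_on; have -> // : \- (\- g) = g by apply/funext => y /=; rewrite opprK.
Qed.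

(* The minorant is the constant c raised above an arbitrary lsc minorant on an
   open set. *)
Lemma lsc_envelope_ge_cst A (U : set Z) f c z : open U ->
  unif_locally_bounded A (fun=> f) ->
  (forall y, U y -> A y -> c <= f y) -> A z -> U z -> c <= lsc_envelope A f z.
Proof.
(* Local boundedness makes the half-relaxed lower limit of the constant sequence a real-valued lsc
   minorant to start from. *)
move=> oU bf cf Az Uz; set h := hr_liminf A (fun=> f).
have hf y : A y -> h y <= f y by move=> Ay; exact: hr_liminf_cst_le.
have /lsc_onP lh : lsc_on A h by exact: lsc_on_hr_liminf.
pose g y := if y \in U then Num.max c (h y) else h y.
have hg y : h y <= g y by rewrite /g; case: ifP => // _; rewrite le_max lexx orbT.
apply: (@le_trans _ _ (g z)); first by rewrite /g mem_set// le_max lexx.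
apply: lsc_envelope_ge => //; last first.
  move=> y Ay; rewrite /g; case: ifPn => [/set_mem Uy|_]; last exact: hf.
  by rewrite ge_max cf// hf.
apply/lsc_onP => y a Ay; rewrite {1}/g; case: ifPn => [/set_mem Uy|_]; last first.
  by move=> /(lh _ _ Ay); apply: filterS => w ahw; exact: lt_le_trans (hg w).
rewrite lt_max => /orP[ac|/(lh _ _ Ay)]; last first.
  by apply: filterS => w ahw; exact: lt_le_trans (hg w).
have : nbhs y U by exact: open_nbhs_nbhs.
rewrite near_withinE; apply: filterS => w Uw _; rewrite /g mem_set//.
by rewrite lt_max ac.
Qed.

(** A lower bound [c] on [Fs n] over a relatively open set survives the lsc envelope, because the
    constant [c] is locally an admissible minorant. Thus the limit of the [Fs n] controls the
    envelopes that occur in the subsolution inequalities. *)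
Lemma hr_liminf_lt_lsc_envelope A (Fs : nat -> Z -> R) z c :
  unif_locally_bounded A Fs -> A z -> c < hr_liminf A Fs z ->
  \forall n \near \oo & y \near within A (nbhs z), c <= lsc_envelope A (Fs n) y.
Proof.
move=> bF Az; rewrite hr_liminfE /= ltrNr => lF.
have [[P V] [/= FP zV] PV] :=
  hr_limsup_lt _ _ _ _ (unif_locally_boundedN _ _ bF) Az lF.
exists (P, (interior (fun y => A y -> V y)) `&` A) => /=.
  split=> //; rewrite /within/=.
  have := zV; rewrite /within/= => /nbhs_interior.
  by apply: filterS => y.
move=> [n y] /= [Pn [yV Ay]].
apply: (@lsc_envelope_ge_cst _ (interior (fun y => A y -> V y))) => //.
- exact: open_interior.
- exact: unif_locally_bounded_cst.
- move=> w /interior_subset Vw Aw; have := PV (n, w); rewrite /= ltrN2 => PVw.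
  by apply/ltW/PVw; split => //; exact: Vw.
Qed.

End HalfRelaxed.

(** Strict upper bounds of [f] hold locally by semicontinuity, and near-covering turns them into one
    bound on all of [K]. Levels tending to [+oo] give boundedness; if the supremum [s] were not
    attained, levels tending to [s] from below would give an upper bound smaller than [s]. *)
Lemma compact_usc_max (R : realType) (Z : topologicalType) (K : set Z)
    (f : Z -> R) : compact K -> K !=set0 -> usc_on K f ->
  exists2 z, K z & forall y, K y -> f y <= f z.
Proof.
move=> /compact_near_coveringP/near_covering_withinP cK [k0 Kk0] /usc_onP uf.
have fK : has_sup (f @` K).
  split; first by exists (f k0), k0.
  have : \forall M \near +oo, K `<=` (fun z => f z < M).
    apply: cK => z Kz.
    exists ([set y | K y -> f y < f z + 1], [set M | f z + 1 < M]) => /=.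
      split; last by apply: nbhs_pinfty_gt; exact: num_real.
      by apply: uf => //; rewrite ltrDl.
    by move=> [y M] /= [fy zM] Ky; exact: lt_trans (fy Ky) zM.
  move=> /filter_ex[M KM]; exists M => _ [z Kz <-]; exact/ltW/KM.
apply: contrapT => nmax; pose s := sup (f @` K).
have fs z : K z -> f z < s.
  move=> Kz; rewrite lt_neqAle ub_le_sup ?andbT; [|by case: fK|by exists z].
  apply/eqP => fzs; apply: nmax; exists z => // y Ky.
  by rewrite fzs; apply: ub_le_sup; [case: fK|exists y].
have : \forall c \near s^'-, K `<=` (fun z => f z < c).
  apply: cK => z Kz; pose c := (f z + s) / 2.
  have [fzc cs] : f z < c /\ c < s by have := fs z Kz; rewrite /c; split; lra.
  exists ([set y | K y -> f y < c], [set b | c < b]) => /=.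
    by split; [exact: uf|exact: nbhs_left_gt].
  by move=> [y b] /= [fy cb] Ky; exact: lt_trans (fy Ky) cb.
move=> sK.
have [c [cs Kc]] := filter_ex (filterI (nbhs_left_lt s) sK).
have : s <= c by apply: ge_sup; [exists (f k0), k0|move=> _ [z /Kc/ltW ? <-]].
by rewrite leNgt => /negP; apply.
Qed.

(** * Euclidean product, entrywise convergence and compact parabolic neighbourhoods *)

Section DotProduct.
Context {R : realType} {d : nat}.
Local Notation V := 'cV[R]_d.
Implicit Types (p q x y : V) (X : 'M[R]_d).

Lemma dotvE p q : dotv p q = (p^T *m q) 0 0.
Proof. by rewrite mxE; apply: eq_bigr => i _; rewrite mxE. Qed.

Lemma dotvC p q : dotv p q = dotv q p.
Proof. by apply: eq_bigr => i _; rewrite mulrC. Qed.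

Lemma dotvDr p x y : dotv p (x + y) = dotv p x + dotv p y.
Proof. by rewrite !dotvE mulmxDr mxE. Qed.

Lemma dotvDl p x y : dotv (x + y) p = dotv x p + dotv y p.
Proof. by rewrite dotvC dotvDr !(dotvC p). Qed.

Lemma dotvZl p x (c : R) : dotv (c *: x) p = c * dotv x p.
Proof. by rewrite mulr_sumr; apply: eq_bigr => i _; rewrite mxE mulrA. Qed.

Lemma dotv_ge0 p : 0 <= dotv p p.
Proof. by apply: sumr_ge0 => i _; rewrite -expr2 sqr_ge0. Qed.

Lemma dotv_sym X x y : X^T = X -> dotv (X *m x) y = dotv (X *m y) x.
Proof.
by move=> XT; rewrite dotvE trmx_mul XT -mulmxA -dotvE dotvC.
Qed.

Lemma sqr_coord_le_dotv p i : p i 0 ^+ 2 <= dotv p p.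
Proof.
rewrite /dotv (bigD1 i)//= -expr2 lerDl.
by apply: sumr_ge0 => j _; rewrite -expr2 sqr_ge0.
Qed.

Lemma cvg_sum_ord (T : Type) (F : set_system T) n (f : 'I_n -> T -> R)
    (a : 'I_n -> R) : Filter F -> (forall i, f i t @[t --> F] --> a i) ->
  \sum_(i < n) f i t @[t --> F] --> \sum_(i < n) a i.
Proof.
move=> FF fa; apply: cvg_big => [[x y]|i _]; last exact: fa.
by apply: cvgD; [exact: cvg_fst|exact: cvg_snd].
Qed.

Lemma cvg_coord (T : Type) (F : set_system T) m n (f : T -> 'M[R]_(m, n))
    (A : 'M[R]_(m, n)) i j : f @ F --> A -> f t i j @[t --> F] --> A i j.
Proof. by move=> fA; exact: (cvg_comp _ _ fA (@coord_continuous R m n i j A)). Qed.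

Lemma cvg_dotv (T : Type) (F : set_system T) (f g : T -> V) x y : Filter F ->
  f @ F --> x -> g @ F --> y -> dotv (f t) (g t) @[t --> F] --> dotv x y.
Proof.
move=> FF fx gy; apply: cvg_sum_ord => i.
by apply: cvgM; exact: cvg_coord.
Qed.

Lemma cvg_mx (T : Type) (F : set_system T) m n (f : T -> 'M[R]_(m, n))
    (A : 'M[R]_(m, n)) : Filter F -> (forall i j, f t i j @[t --> F] --> A i j) -> f @ F --> A.
Proof.
move=> FF fA; apply/cvg_ballP => e e0; rewrite near_simpl.
have : \forall t \near F, forall i j, ball (A i j) e (f t i j).
  apply: filter_forall => i; apply: filter_forall => j.
  by move: (fA i j) => /cvg_ballP; exact.
by apply: filterS => t At; split.
Qed.

Lemma cvg_mulmx (T : Type) (F : set_system T) X (f : T -> V) x : Filter F ->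
  f @ F --> x -> X *m f t @[t --> F] --> X *m x.
Proof.
move=> FF fx; apply: cvg_mx => i j; rewrite mxE.
under eq_cvg do rewrite mxE.
apply: cvg_sum_ord => k.
apply: cvgM; first exact: cvg_cst.
exact: cvg_coord.
Qed.

Lemma compact_parabolic_nbhs (z0 : V * R) (W : set (V * R)) : nbhs z0 W ->
  exists (K : set (V * R)) (k : R), [/\ compact K, K `<=` W, 0 < k &
    forall z, `|z.2 - z0.2| + dotv (z.1 - z0.1) (z.1 - z0.1) < k -> K z].
Proof.
move=> /nbhs_ballP[e /= e0 eW]; pose r := e / 2.
have r0 : 0 < r by rewrite /r; lra.
(* The box is made of row vectors, to which [rV_compact] applies, and is then transposed. *)
pose KV : set 'rV[R]_d := [set v | forall i,
  `[z0.1 i 0 - r, z0.1 i 0 + r]%classic (v ord0 i)].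
exists ((trmx @` KV) `*` `[z0.2 - r, z0.2 + r]%classic), (Num.min r (r ^+ 2)).
split.
- apply: compact_setX; last exact: segment_compact.
  apply: continuous_compact.
    apply: continuous_subspaceT => v.
    apply: (cvg_mx _ (nbhs v) _ _ _ _ (nbhs_filter v)) => i j.
    rewrite mxE; under eq_cvg do rewrite mxE; exact: coord_continuous.
  exact: (@rV_compact R d (fun i => `[z0.1 i 0 - r, z0.1 i 0 + r]%classic)
    (fun i => @segment_compact R _ _)).
- move=> [x t] [/= [v vr <-] tr]; suff : ball z0 e (v^T, t) by move=> /eW.
  split => /=.
    split => // i j; rewrite ord1 mxE /ball/=.
    have := vr i; rewrite /= in_itv/= => /andP[v1 v2]; rewrite ltr_distlC; apply/andP; split.
      by apply: lt_le_trans v1; rewrite /r; lra.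
    by apply: le_lt_trans v2 _; rewrite /r; lra.
  move: tr; rewrite /= in_itv/= => /andP[t1 t2]; rewrite /ball/= ltr_distlC; apply/andP; split.
    by apply: lt_le_trans t1; rewrite /r; lra.
  by apply: le_lt_trans t2 _; rewrite /r; lra.
- by rewrite lt_min r0 exprn_gt0.
move=> [x t] /=; rewrite lt_min => /andP[lt1 lt2]; split => /=; last first.
  rewrite in_itv/= -ler_distlC distrC.
  by apply/ltW; apply: le_lt_trans lt1; rewrite lerDl dotv_ge0.
exists (x^T); last by rewrite trmxK.
move=> i; rewrite mxE /= in_itv/= -ler_distlC distrC.
rewrite -ler_sqr ?nnegrE// ?(ltW r0)// real_normK ?num_real//.
apply/ltW; apply: le_lt_trans lt2.
have := sqr_coord_le_dotv (x - z0.1) i; rewrite !mxE => /le_trans -> //.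
by rewrite lerDr.
Qed.

End DotProduct.

(** * Parabolic jets and their stability under half-relaxed limits *)

Section Jets.
Context {R : realType} {d : nat}.
Local Notation V := 'cV[R]_d.
Implicit Types (D : set (V * R)) (u : V * R -> R) (z : V * R) (p : V)
  (X : 'M[R]_d).

Definition gauge z0 z := `|z.2 - z0.2| + dotv (z.1 - z0.1) (z.1 - z0.1).

Definition taylor z0 a p X z := a * (z.2 - z0.2) + dotv p (z.1 - z0.1)
  + 2^-1 * dotv (X *m (z.1 - z0.1)) (z.1 - z0.1).

Lemma gauge_ge0 z0 z : 0 <= gauge z0 z.
Proof. by rewrite addr_ge0// dotv_ge0. Qed.

(** The little-o term is traded for a margin [e * gauge] for every [e]. Conversely, the positive
    part of the defect is the least nonnegative remainder, and the margins say that it is negligible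
    against the gauge. *)
Lemma superjetP D u z0 a p X : superjet D u z0 (a, p, X) <->
  X^T = X /\ forall e, 0 < e -> \forall z \near within D (nbhs z0),
    u z <= u z0 + taylor z0 a p X z + e * gauge z0 z.
Proof.
split=> [[XT [r /eqoP ro ur]]|[XT ur]]; split => //.
  move=> e e0; apply: filterS2 ur (ro _ e0) => z /= uz.
  rewrite [X in _ * X]ger0_norm ?gauge_ge0// => rz.
  apply: le_trans uz _; rewrite /taylor !addrA lerD2l.
  by apply: le_trans rz; exact: ler_norm.
pose r z := Num.max 0 (u z - u z0 - taylor z0 a p X z) : R^o.
exists r; last first.
  apply: nearW => z; have : u z - u z0 - taylor z0 a p X z <= r z.
    by rewrite le_max lexx orbT.
  by rewrite /taylor; lra.
apply/eqoP => e e0; apply: filterS (ur e e0) => z uz.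
have g0 := gauge_ge0 z0 z.
rewrite [X in _ * X]ger0_norm// [leLHS]ger0_norm; last by rewrite le_max lexx.
rewrite ge_max mulr_ge0 ?(ltW e0)//=.
by rewrite -/(gauge z0 z); lra.
Qed.

Lemma cvg_subl z0 z : w.1 - z0.1 @[w --> z] --> z.1 - z0.1.
Proof. by apply: cvgB; [exact: cvg_fst|exact: cvg_cst]. Qed.

Lemma cvg_subr z0 z : w.2 - z0.2 @[w --> z] --> z.2 - z0.2.
Proof. by apply: cvgB; [exact: cvg_snd|exact: cvg_cst]. Qed.

Lemma continuous_gauge z0 : continuous (gauge z0).
Proof.
move=> z; apply: cvgD; first by apply: cvg_norm; exact: cvg_subr.
by apply: cvg_dotv; exact: cvg_subl.
Qed.

Lemma continuous_taylor z0 a p X : continuous (taylor z0 a p X).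
Proof.
move=> z; apply: cvgD; [apply: cvgD|apply: cvgM; first exact: cvg_cst].
- by apply: cvgM; [exact: cvg_cst|exact: cvg_subr].
- by apply: cvg_dotv; [exact: cvg_cst|exact: cvg_subl].
by apply: cvg_dotv; [apply: cvg_mulmx|]; exact: cvg_subl.
Qed.

Lemma taylor_id z0 a p X : taylor z0 a p X z0 = 0.
Proof.
by rewrite /taylor !subrr !dotvE mulr0 !mulmx0 !mxE mulr0 !addr0.
Qed.

Lemma gauge_id z0 : gauge z0 z0 = 0.
Proof. by rewrite /gauge !subrr normr0 dotvE mulmx0 mxE addr0. Qed.

(** The nonsmooth [|t - t0|] of the gauge is replaced by a square, so that touching by this function
    produces jets. The coefficients are separate because [b] must grow as the localisation gets
    finer, while [c] stays small. *)
Definition test_fun z0 a p X (b c : R) z :=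
  taylor z0 a p X z + b * (z.2 - z0.2) ^+ 2
  + c * dotv (z.1 - z0.1) (z.1 - z0.1).

Lemma continuous_test_fun z0 a p X b c : continuous (test_fun z0 a p X b c).
Proof.
move=> z; apply: cvgD; first apply: cvgD; first exact: continuous_taylor.
  apply: cvgM; first exact: cvg_cst.
  by apply: cvgM; exact: cvg_subr.
by apply: cvgM; [exact: cvg_cst|apply: cvg_dotv; exact: cvg_subl].
Qed.

Lemma test_fun_id z0 a p X b c : test_fun z0 a p X b c z0 = 0.
Proof.
rewrite /test_fun taylor_id !subrr expr0n /= dotvE mulmx0 mxE.
by rewrite !mulr0 !addr0.
Qed.

(** A quadratic polynomial equals its expansion at [z1]. Parabolic jets have no second-order entry
    in time, so the square with coefficient [b] is left as a remainder. *)
Lemma test_fun_expand z0 a p X b c z1 z : X^T = X ->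
  test_fun z0 a p X b c z = test_fun z0 a p X b c z1
    + taylor z1 (a + 2 * b * (z1.2 - z0.2))
        (p + X *m (z1.1 - z0.1) + (2 * c) *: (z1.1 - z0.1))
        (X + (2 * c)%:M) z
    + b * (z.2 - z1.2) ^+ 2.
Proof.
move=> XT; rewrite /test_fun /taylor.
have -> : z.1 - z0.1 = (z.1 - z1.1) + (z1.1 - z0.1) by rewrite addrA subrK.
have -> : z.2 - z0.2 = (z.2 - z1.2) + (z1.2 - z0.2) by rewrite addrA subrK.
move: (z.1 - z1.1) (z.2 - z1.2) (z1.1 - z0.1) (z1.2 - z0.2) => y s x t.
rewrite mulmxDr mulmxDl mul_scalar_mx !(dotvDl, dotvDr, dotvZl).
by rewrite (dotv_sym _ y x XT) (dotvC y x); field.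
Qed.

Lemma superjet_local_max D u z0 a p X b c z1 : X^T = X ->
  (\forall z \near within D (nbhs z1),
    u z - test_fun z0 a p X b c z <= u z1 - test_fun z0 a p X b c z1) ->
  superjet D u z1 (a + 2 * b * (z1.2 - z0.2),
    p + X *m (z1.1 - z0.1) + (2 * c) *: (z1.1 - z0.1), X + (2 * c)%:M).
Proof.
move=> XT umax; apply/superjetP; split.
  by rewrite linearD /= XT tr_scalar_mx.
move=> e e0; have b0 : 0 < `|b| + 1 by rewrite ltr_wpDl.
(* Here the remainder [b * tau ^+ 2] is at most [e * |tau|], with [tau] the time increment, so it
   fits in the margin; adding 1 avoids dividing by zero. *)
have small : \forall z \near within D (nbhs z1), `|z.2 - z1.2| < e / (`|b| + 1).
  rewrite near_withinE; have /cvg_norm := cvg_subr z1 z1.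
  rewrite subrr normr0 => /cvgr_lt/(_ (e / (`|b| + 1))).
  by rewrite divr_gt0// => /(_ isT); apply: filterS.
apply: filterS2 umax small => z uz sz.
move: uz; rewrite (@test_fun_expand z0 _ _ _ _ _ z1 z XT) => uz.
have : b * (z.2 - z1.2) ^+ 2 <= e * gauge z1 z; last by lra.
rewrite -[_ ^+ 2]real_normK ?num_real//.
apply: (@le_trans _ _ (e * `|z.2 - z1.2|)); last first.
  by rewrite ler_pM2l// lerDl dotv_ge0.
rewrite expr2 mulrA ler_wpM2r//.
move: sz; rewrite ltr_pdivlMr// mulrC => /ltW; apply: le_trans.
by rewrite ler_wpM2r// (le_trans (ler_norm _))// lerDl.
Qed.

(* u_n - test_fun is maximised over a compact neighbourhood K of z0. With
   [tau] the time increment, [|tau| <= tau^2 / (2 eta) + eta / 2], so the test function with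
   [b = delta / (2 eta)] dominates the Taylor polynomial plus
   [delta * gauge] up to [delta * eta / 2]; hence, for large n, the maximum is
   attained where [gauge < 2 eta], and there the slope [2 b tau] that b adds is
   at most [2 delta], however small eta is. *)
Lemma superjet_hr_limsup D (us : nat -> V * R -> R) z0 a p X :
  open D -> unif_locally_bounded D us -> (forall n, usc_on D (us n)) ->
  D z0 -> superjet D (hr_limsup D us) z0 (a, p, X) ->
  forall (e : R) (N : nat), 0 < e -> exists n z a' p' X',
    [/\ (N <= n)%N, D z,
        ball (z0, hr_limsup D us z0, a, p, X) e (z, us n z, a', p', X') &
        superjet D (us n) z (a', p', X')].
Proof.
move=> oD bu uu Dz0 /superjetP[XT uX] e N e0.
set u := hr_limsup D us in uX *.
(* The slope in time and the matrix will move by at most [2 * del = e / 4], and the value at the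
   maximum will drop by less than [e / 2 + del]. *)
have [del delE] : exists del, 8 * del = e by exists (e / 8); lra.
have del0 : 0 < del by lra.
have Dn z : D z -> within D (nbhs z) = nbhs z.
  by move=> Dz; apply: within_interior; exact: open_nbhs_nbhs.
have [[P U] [/= FP z0U] PU] : \forall n \near \oo & z \near z0, us n z < u z0 + e.
  have := hr_limsup_lt D us z0 (u z0 + e) bu Dz0.
  by rewrite (Dn _ Dz0) ltrDl; apply.
(* These are the conditions to be met on the whole compact set [K]. The jet inequality is taken with
   [del / 2], half of the coefficient in the test function; the other half makes [u - phi] decrease
   away from [z0]. *)
have z0W : \forall z \near z0, [/\ U z, D z, ball z0 e z,
    ball p e (p + X *m (z.1 - z0.1) + (2 * del) *: (z.1 - z0.1)) &
    - (e / 2) < taylor z0 a p X z /\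
    u z <= u z0 + taylor z0 a p X z + del / 2 * gauge z0 z].
  have z0D : nbhs z0 D by exact: open_nbhs_nbhs.
  have z0u : \forall z \near z0,
      u z <= u z0 + taylor z0 a p X z + del / 2 * gauge z0 z.
    by have := uX (del / 2); rewrite (Dn _ Dz0); apply; rewrite divr_gt0.
  have z0p : \forall z \near z0,
      ball p e (p + X *m (z.1 - z0.1) + (2 * del) *: (z.1 - z0.1)).
    have : p + X *m (z.1 - z0.1) + (2 * del) *: (z.1 - z0.1) @[z --> z0] -->
        p + X *m (z0.1 - z0.1) + (2 * del) *: (z0.1 - z0.1).
      apply: cvgD; [apply: cvgD; first exact: cvg_cst|apply: cvgZr].
        by apply: cvg_mulmx; exact: cvg_subl.
      exact: cvg_subl.
    by rewrite subrr mulmx0 scaler0 !addr0 => /cvg_ballP; exact.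
  have z0t : \forall z \near z0, - (e / 2) < taylor z0 a p X z.
    have /cvgr_gt := @continuous_taylor z0 a p X z0; apply.
    by rewrite taylor_id; lra.
  near=> z; split.
  - by near: z.
  - by near: z.
  - by near: z; exact: nbhsx_ballx.
  - by near: z.
  - by split; near: z.
have [K [k [cK KW k0 kK]]] := compact_parabolic_nbhs z0 _ z0W.
have [eta [eta0 etak eta1]] : exists eta, [/\ 0 < eta, 2 * eta <= k & 2 * eta <= 1].
  exists (Num.min k 1 / 2); rewrite divr_gt0 ?lt_min ?k0//=.
  by rewrite mulrC divfK// !ge_min !lexx orbT.
have [b [be b0]] : exists b, b * (2 * eta) = del /\ 0 < b.
  exists (del / (2 * eta)); rewrite divr_gt0 ?mulr_gt0//.
  by rewrite divfK// mulf_neq0// gt_eqF.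
have [phi phiE] : exists phi, phi = test_fun z0 a p X b del by eexists.
have phi_ge z : taylor z0 a p X z + del * gauge z0 z - del * eta / 2 <= phi z.
  have : 0 <= b * (`|z.2 - z0.2| - eta) ^+ 2 by rewrite mulr_ge0 ?sqr_ge0// ltW.
  rewrite phiE /test_fun /gauge -(real_normK (num_real (z.2 - z0.2))).
  by rewrite sqrrB -be; lra.
have de0 : 0 < del * eta by rewrite mulr_gt0.
(* Where [gauge >= 2 * eta], the jet inequality and [phi_ge] give [u - phi <= u z0 - del * eta / 2],
   that is [u z0 - 8 * g]. This leaves room for an error [g] from [us n] and another from [phi]. *)
have [g gE] : exists g, 16 * g = del * eta by exists (del * eta / 16); lra.
have g0 : 0 < g by lra.
have phi_cts : continuous phi by rewrite phiE; exact: continuous_test_fun.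
have phi0 : phi z0 = 0 by rewrite phiE; exact: test_fun_id.
pose C := K `&` [set z | 2 * eta <= gauge z0 z].
have cC : compact C.
  apply: compact_closedI => //.
  apply: (@closed_comp _ _ (gauge z0) [set t | 2 * eta <= t]).
    by move=> z _; exact: continuous_gauge.
  exact: closed_ge.
have CP : \forall n \near \oo, C `<=` (fun z => us n z - phi z < u z0 - 4 * g).
  move/compact_near_coveringP : cC; apply => z [Kz gz].
  have [_ Dz _ _ [_ uz]] := KW _ Kz.
  have us_lt : \forall n \near \oo & y \near z, us n y < u z + g.
    have := hr_limsup_lt D us z (u z + g) bu Dz.
    by rewrite (Dn _ Dz) ltrDl; apply.
  have phi_gt : \forall y \near z, phi z - g < phi y.
    by apply: (cvgr_gt _ (phi_cts z)); rewrite ltrBlDr ltrDl.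
  move: us_lt => [[P' V'] [/= FP' zV'] us_lt].
  exists (V' `&` (fun y => phi z - g < phi y), P') => /=.
    by split => //; exact: filterI.
  move=> [y n] /= [[V'y phiy] P'n].
  have uy : us n y < u z + g := us_lt (n, y) (conj P'n V'y).
  have := ler_wpM2l (ltW del0) gz.
  move: uy uz phiy gE g0 (phi_ge z).
  move: (us n y) (u z) (phi y) (phi z) (taylor z0 a p X z) (gauge z0 z) (u z0).
  clear => *; lra.
(* Otherwise [us n <= u z0 - 4 * g + phi] near [z0] for all large [n]; since [phi < g] near [z0],
   the half-relaxed limit at [z0] would lie below its own value. *)
have freq M : exists n y, [/\ (M <= n)%N, K y & u z0 - 4 * g < us n y - phi y].
  apply: contrapT => nfreq.
  have : hr_limsup D us z0 <= u z0 - 3 * g; last by rewrite -/u; lra.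
  apply: hr_limsup_le => //; rewrite Dn//.
  exists ([set n | (M <= n)%N], K `&` (fun y => phi y < g)) => /=.
    split; first by exists M.
    apply: filterI; last by apply: (cvgr_lt _ (phi_cts z0)); rewrite phi0.
    have : \forall z \near z0, gauge z0 z < k.
      by apply: (cvgr_lt _ (continuous_gauge z0 z0)); rewrite gauge_id.
    by apply: filterS; exact: kK.
  move=> [n y] /= [Mn [Ky phiy]]; rewrite leNgt; apply/negP => usy.
  by apply: nfreq; exists n, y; split => //; lra.
have [M _ CM] := CP; have [M' _ PM] := FP.
have [n [y [nM Ky ym]]] := freq (maxn N (maxn M M')).
move: nM; rewrite !geq_max => /and3P[Nn Mn M'n].
have [z Kz zmax] : exists2 z, K z &
    forall w, K w -> us n w - phi w <= us n z - phi z.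
  apply: compact_usc_max => //; first by exists y.
  apply/usc_onP => z c Kz zc; rewrite near_withinE.
  have [h hE] : exists h, 2 * h = c - (us n z - phi z).
    by exists ((c - (us n z - phi z)) / 2); lra.
  have h0 : 0 < h by lra.
  have [_ Dz _ _ _] := KW _ Kz.
  have us_lt : \forall w \near z, us n w < us n z + h.
    have /usc_onP/(_ _ (us n z + h) Dz) := uu n.
    by rewrite (Dn _ Dz) ltrDl; apply.
  have phi_gt : \forall w \near z, phi z - h < phi w.
    by apply: (cvgr_gt _ (phi_cts z)); rewrite ltrBlDr ltrDl.
  by apply: filterS2 us_lt phi_gt => w + + _; lra.
have zm := lt_le_trans ym (zmax _ Ky).
(* The maximum is at least the value at [y], which exceeds the bound valid on [C]. Being outside
   [C], the point [z] has a neighbourhood contained in [K], so the maximum over [K] is a local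
   one. *)
have gz : gauge z0 z < 2 * eta.
  rewrite ltNge; apply/negP => gz.
  by have := CM n Mn z (conj Kz gz); rewrite ltNge (ltW zm).
have [Uz Dz z0z pz [tz _]] := KW _ Kz.
exists n, z, (a + 2 * b * (z.2 - z0.2)),
  (p + X *m (z.1 - z0.1) + (2 * del) *: (z.1 - z0.1)), (X + (2 * del)%:M).
split => //; last first.
  apply: superjet_local_max => //; rewrite (Dn _ Dz) -phiE.
  have : \forall w \near z, gauge z0 w < 2 * eta.
    exact: (cvgr_lt _ (continuous_gauge z0 z)).
  by apply: filterS => w gw; apply: zmax; apply: kK; exact: lt_le_trans etak.
split; [split; [split; [split => //|]|done]|].
- have := PU (n, z) (conj (PM n M'n) Uz); have := phi_ge z; have := gauge_ge0 z0 z.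
  rewrite /ball/= ltr_distlC => g0z phiz uz; rewrite uz andbT.
  have := mulr_ge0 (ltW del0) g0z.
  have : del * (2 * eta) <= del by rewrite ler_piMr// ltW.
  by move: zm phiz tz; lra.
- rewrite /ball/= opprD addrA subrr add0r normrN !normrM (gtr0_norm b0) gtr0_norm//.
  have : `|z.2 - z0.2| < 2 * eta by apply: le_lt_trans gz; rewrite lerDl dotv_ge0.
  rewrite -(ltr_pM2l b0) be; lra.
- split => // i j; rewrite /ball/= !mxE opprD addrA subrr add0r normrN.
  case: (i == j); rewrite ?mulr1n ?mulr0n ?normr0// ger0_norm; lra.
Unshelve. all: by end_near. Qed.

End Jets.

(** * Uniform convergence along moving points, and extraction of subsequences *)

Lemma uniform_cvgP (R : realType) (U : choiceType) (A : set U)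
    (gs : nat -> U -> R) (g : U -> R) :
  {uniform A, gs @ \oo --> g} <-> forall e, 0 < e ->
    \forall n \near \oo, forall y, A y -> `|g y - gs n y| < e.
Proof.
split=> [gsg e e0|gsg P /uniform_nbhs[E [+ EP]]].
  apply: (gsg [set h | forall y, A y -> `|g y - h y| < e]).
  apply/uniform_nbhs; exists [set ab | `|ab.1 - ab.2| < e]; split => //.
  by rewrite -entourage_ballE; exists e.
rewrite -entourage_ballE => -[e /= e0 eE].
by have := gsg e e0; apply: filterS => n gn; apply: EP => y Ay; apply: eE; exact: gn.
Qed.

(** The triangle inequality goes through [g (z_ k)]: uniform convergence compares [gs (m k)] with
    [g] at the moving point, and continuity of the uniform limit does the rest. *)
Lemma uniform_cvg_within (R : realType) (Z : topologicalType) (A : set Z)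
    (gs : nat -> Z -> R) (g : Z -> R) (m : nat -> nat) (z_ : nat -> Z) z :
  (forall n, {within A, continuous (gs n)}) ->
  {uniform A, gs @ \oo --> g} -> m @ \oo --> \oo ->
  (forall k, A (z_ k)) -> z_ @ \oo --> z -> A z ->
  gs (m k) (z_ k) @[k --> \oo] --> g z.
Proof.
move=> cgs gsg moo Az_ z_z Az.
have cg : {within A, continuous g}.
  apply: (@uniform_limit_continuous_subspace _ R A (gs @ \oo)) => //.
  by exists 0%N => // n _; exact: cgs.
have z_within : z_ @ \oo --> within A (nbhs z).
  move=> P zP; have := z_z (fun y => A y -> P y) zP.
  by apply: (@filterS nat \oo) => k /(_ (Az_ k)).
have gz : g (z_ k) @[k --> \oo] --> g z.
  by have /subspace_continuousP/(_ z Az) := cg; exact: (cvg_comp _ _ z_within).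
apply/cvgrPdist_lt => e e0; have e20 : 0 < e / 2 by rewrite divr_gt0.
have /cvgrPdist_lt/(_ _ e20) := gz.
have : \forall k \near \oo, forall y, A y -> `|g y - gs (m k) y| < e / 2.
  by move/uniform_cvgP : gsg => /(_ _ e20)/moo.
apply: filterS2 => k /(_ _ (Az_ k)) h1 h2.
rewrite (splitr e) -(subrK (g (z_ k)) (g z)) -addrA.
by apply: le_lt_trans (ler_normD _ _) _; rewrite ltrD.
Qed.

Lemma increasing_seq_cvg_infty (m : nat -> nat) :
  increasing_seq m -> m @ \oo --> \oo.
Proof.
move=> im; have km k : (k <= m k)%N.
  elim: k => // k IH; apply: leq_ltn_trans IH _.
  by have /increasing_seqP := im; apply.
move=> P [N _ NP]; exists N => // k /= Nk; apply: NP => /=.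
exact: leq_trans Nk (km k).
Qed.

Lemma increasing_choice (T : Type) (P : nat -> nat -> T -> Prop) :
  (forall k N, exists n x, (N <= n)%N /\ P k n x) ->
  exists (m : nat -> nat) (x_ : nat -> T),
    increasing_seq m /\ forall k, P k (m k) (x_ k).
Proof.
move=> HP.
have /choice[f fP] : forall kN : nat * nat, exists nx : nat * T,
    (kN.2 <= nx.1)%N /\ P kN.1 nx.1 nx.2.
  by move=> [k N]; have [n [x nx]] := HP k N; exists (n, x).
(* The successor of the previous index is the lower bound for the next one, which makes the indices
   strictly increasing. *)
pose s := fix s k := if k is k'.+1 then f (k, (s k').1.+1) else f (0%N, 0%N).
exists (fun k => (s k).1), (fun k => (s k).2); split.
  by apply/increasing_seqP => k; have [] := fP (k.+1, (s k).1.+1).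
case=> [|k]; first by have [] := fP (0%N, 0%N).
by have [] := fP (k.+1, (s k).1.+1).
Qed.

Lemma cvg_comp_fst (T : Type) (F : set_system T) (X Y : topologicalType)
    (f : T -> X * Y) (z : X * Y) : Filter F -> f @ F --> z -> (f t).1 @[t --> F] --> z.1.
Proof. by move=> FF fz; apply: (cvg_comp _ _ fz); exact: cvg_fst. Qed.

Lemma cvg_comp_snd (T : Type) (F : set_system T) (X Y : topologicalType)
    (f : T -> X * Y) (z : X * Y) : Filter F -> f @ F --> z -> (f t).2 @[t --> F] --> z.2.
Proof. by move=> FF fz; apply: (cvg_comp _ _ fz); exact: cvg_snd. Qed.

(** * Passage to the limit in the inclusions *)

Section Limit.
Context {R : realType} {d : nat}.
Local Notation V := 'cV[R]_d.
Local Notation M := 'M[R]_d.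

(** Jets and solutions are stripped off: the inequalities are only assumed at points of the domain
    of the operators approaching [z], so that the same argument serves both halves of the
    theorem. *)
Lemma limit_inclusion (Omega : set V) (I : set R)
    (F_ : nat -> V * R * R * R * V * M -> R) (G_ : nat -> V * R * R * V -> R)
    (G : V * R * R * V -> R) (S_ : nat -> R -> set R) (S : R -> set R) z :
  unif_locally_bounded (dom_F Omega I) F_ ->
  (forall n, {within dom_G Omega I, continuous (G_ n)}) ->
  {uniform dom_G Omega I, G_ @ \oo --> G} ->
  multimaps_converge S_ S -> dom_F Omega I z ->
  (forall (e : R) N, 0 < e -> exists n w mu, [/\ (N <= n)%N, dom_F Omega I w,
     ball z e w, S_ n w.1.1.2 mu &
     lsc_envelope (dom_F Omega I) (F_ n) w <= mu * G_ n (w.1.1.1, w.1.2)]) ->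
  exists2 mu, S z.1.1.2 mu &
    lsc_envelope (dom_F Omega I) (hr_liminf (dom_F Omega I) F_) z
      <= mu * G (z.1.1.1, z.1.2).
Proof.
set A := dom_F Omega I => bF cG GG SS Az approx.
have [k N|m [x_ [im xP]]] := increasing_choice _ (fun k n x =>
    [/\ A x.1, ball z k.+1%:R^-1 x.1, S_ n x.1.1.1.2 x.2 &
     lsc_envelope A (F_ n) x.1 <= x.2 * G_ n (x.1.1.1.1, x.1.1.2)]).
  have [|n [w [mu [Nn Aw zw Smu Fw]]]] := approx k.+1%:R^-1 N.
    by rewrite invr_gt0.
  by exists n, (w, mu).
have wz : (x_ k).1 @[k --> \oo] --> z.
  by apply: cvg_ball_inv => k; have [] := xP k.
have w1 : (x_ k).1.1 @[k --> \oo] --> z.1 by exact: cvg_comp_fst.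
have w11 : (x_ k).1.1.1 @[k --> \oo] --> z.1.1 by exact: cvg_comp_fst.
have w111 : (x_ k).1.1.1.1 @[k --> \oo] --> z.1.1.1 by exact: cvg_comp_fst.
have w12 : (x_ k).1.1.2 @[k --> \oo] --> z.1.2 by exact: cvg_comp_snd.
have wa : (x_ k).1.1.1.2 @[k --> \oo] --> z.1.1.2 by exact: cvg_comp_snd.
(* The time slopes converge along the indices [m], so the hypothesis on the multimaps yields a
   further subsequence on which the selected [mu] converge. *)
have [|k [mu [ik xmu Smu]]] := SS m _ (snd \o x_) _ im wa.
  by move=> j; have [] := xP j.
exists mu => //; rewrite lsc_envelope_id//; last exact: lsc_on_hr_liminf.
have koo := increasing_seq_cvg_infty _ ik.
have Gw : G_ (m (k j)) ((x_ (k j)).1.1.1.1, (x_ (k j)).1.1.2) @[j --> \oo] -->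
    G (z.1.1.1, z.1.2).
  apply: (cvg_comp k (fun j => G_ (m j) ((x_ j).1.1.1.1, (x_ j).1.1.2)) koo).
  have := uniform_cvg_within _ _ (dom_G Omega I) G_ G m
    (fun j => ((x_ j).1.1.1.1, (x_ j).1.1.2)) (z.1.1.1, z.1.2) cG GG.
  apply.
  - exact: increasing_seq_cvg_infty.
  - by move=> j; have [[]] := xP j.
  - exact: (cvg_pair w111 w12).
  - by case: Az.
rewrite leNgt; apply/negP => muG.
set l := hr_liminf A F_ z in muG.
(* Along the subsequence the right-hand sides eventually fall below [c], while the envelopes stay at
   or above [c]. *)
have [c [muc cl]] : exists c, mu * G (z.1.1.1, z.1.2) < c /\ c < l.
  by exists ((mu * G (z.1.1.1, z.1.2) + l) / 2); split; lra.
have [[P U] [/= FP zU] PU] := hr_liminf_lt_lsc_envelope A F_ z c bF Az cl.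
have jP : \forall j \near \oo, P (m (k j)).
  exact: koo _ (increasing_seq_cvg_infty _ im _ FP).
have jU : \forall j \near \oo, A (x_ (k j)).1 -> U (x_ (k j)).1.
  exact: koo _ (wz (fun w => A w -> U w) zU).
have jc : \forall j \near \oo,
    (x_ (k j)).2 * G_ (m (k j)) ((x_ (k j)).1.1.1.1, (x_ (k j)).1.1.2) < c.
  exact: (cvgr_lt _ (cvgM xmu Gw)).
have [j [[Pj Uj] jcj]] := filter_ex (filterI (filterI jP jU) jc).
have [Aj _ _ Fj] := xP (k j).
have := PU (m (k j), (x_ (k j)).1) (conj Pj (Uj Aj)).
by rewrite /= leNgt (le_lt_trans Fj).
Qed.

End Limit.

(** * Openness of the domain, reflection of balls, and the two halves of the theorem *)

Lemma open_setX (X Y : topologicalType) (A : set X) (B : set Y) :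
  open A -> open B -> open (A `*` B).
Proof.
move=> oA oB; rewrite openE => -[x y] [Ax By].
by exists (A, B) => //; split; exact: open_nbhs_nbhs.
Qed.

Lemma ballN (R : realType) (Z : pseudoMetricNormedZmodType R) (x y : Z) (e : R) :
  ball x e y -> ball (- x) e (- y).
Proof. by rewrite -ball_normE /= -opprD normrN. Qed.

Theorem theorem2p15 (R : realType) (d : nat) (Omega : set 'cV[R]_d) (T : R)
    (F_ : nat -> 'cV[R]_d * R * R * R * 'cV[R]_d * 'M[R]_d -> R)
    (G_ : nat -> 'cV[R]_d * R * R * 'cV[R]_d -> R)
    (G : 'cV[R]_d * R * R * 'cV[R]_d -> R)
    (S_ : nat -> R -> set R) (S : R -> set R) :
  let I : set R := [set` `]0, T[ ] in
  open Omega ->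
  0 < T ->
  unif_locally_bounded (dom_F Omega I) F_ ->
  (forall n, {within dom_G Omega I, continuous (G_ n)}) ->
  (forall n z, dom_G Omega I z -> 0 <= G_ n z) ->
  {uniform dom_G Omega I, G_ @ \oo --> G} ->
  (forall n a, S_ n a !=set0) ->
  (forall a, S a !=set0) ->
  multimaps_converge S_ S ->
  (forall u_ : nat -> 'cV[R]_d * R -> R,
     (forall n, viscosity_subsolution Omega I (F_ n) (S_ n) (G_ n) (u_ n)) ->
     unif_locally_bounded (dom_u Omega I) u_ ->
     viscosity_subsolution Omega I (hr_liminf (dom_F Omega I) F_) S G
       (hr_limsup (dom_u Omega I) u_))
  /\
  (forall u_ : nat -> 'cV[R]_d * R -> R,
     (forall n, viscosity_supersolution Omega I (F_ n) (S_ n) (G_ n) (u_ n)) ->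
     unif_locally_bounded (dom_u Omega I) u_ ->
     viscosity_supersolution Omega I (hr_limsup (dom_F Omega I) F_) S G
       (hr_liminf (dom_u Omega I) u_)).
Proof.
move=> I oO _ bF cG _ GG _ _ SS.
have oD : open (dom_u Omega I) by apply: open_setX => //; exact: interval_open.
split=> u_ sol bu.
- split; first exact: usc_on_hr_limsup.
  move=> x t a p X Ox It uj; have [XT _] := (superjetP _ _ _ _ _ _).1 uj.
  apply: (limit_inclusion Omega I F_ G_ G S_ S
    (x, t, hr_limsup (dom_u Omega I) u_ (x, t), a, p, X)) => // e N e0.
  have [n [[x' t'] [a' [p' [X' [Nn [Ox' It'] zz' uj']]]]]] :=
    superjet_hr_limsup _ u_ (x, t) _ _ _ oD bu (fun n => (sol n).1) (conj Ox It)
      uj e N e0.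
  have [mu Smu Fmu] := (sol n).2 _ _ _ _ _ Ox' It' uj'.
  exists n, (x', t', u_ n (x', t'), a', p', X'), mu; split => //.
  by split => //; have [] := (superjetP _ _ _ _ _ _).1 uj'.
have bNu := unif_locally_boundedN _ _ bu.
have uNu n : usc_on (dom_u Omega I) (\- u_ n).
  by rewrite /usc_on; have -> : \- (\- u_ n) = u_ n;
     [apply/funext => z /=; rewrite opprK|have [] := sol n].
split; first exact: lsc_on_hr_liminf.
move=> x t b q Y Ox It [[[a p] X] uj [<- <- <-]] {b q Y}.
have hN : \- hr_liminf (dom_u Omega I) u_ =
    hr_limsup (dom_u Omega I) (fun n => \- u_ n).
  by apply/funext => z; rewrite hr_liminfE /= opprK.
rewrite hN in uj; have [XT _] := (superjetP _ _ _ _ _ _).1 uj.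
(* [F_ n] and [G_ n] are negated as functions but not reflected in their arguments: the points fed
   to [limit_inclusion] keep the value of [u_ n] and carry the jets [(- a', - p', - X')], which are
   subjets of [u_ n]. *)
have [||||||nu Snu Fnu] := limit_inclusion Omega I (fun n => \- F_ n)
  (fun n => \- G_ n) (\- G) S_ S
  (x, t, hr_liminf (dom_u Omega I) u_ (x, t), - a, - p, - X).
- exact: unif_locally_boundedN.
- by move=> n z; apply: cvgN; exact: cG.
- apply/uniform_cvgP => e e0; move/uniform_cvgP : GG => /(_ e e0).
  by apply: filterS => n Gn y Ay; rewrite /= opprK addrC distrC Gn.
- exact: SS.
- by split => //=; rewrite linearN /= XT.
- move=> e N e0.
  have [n [[x' t'] [a' [p' [X' [Nn [Ox' It'] zz' uj']]]]]] :=
    superjet_hr_limsup _ _ (x, t) _ _ _ oD bNu uNu (conj Ox It) uj e N e0.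
  have sj : subjet (dom_u Omega I) (u_ n) (x', t') (- a', - p', - X').
    by exists (a', p', X').
  have [nu Snu Fnu] := (sol n).2 _ _ _ _ _ Ox' It' sj.
  exists n, (x', t', u_ n (x', t'), - a', - p', - X'), nu; split => //.
  + split => //=; rewrite linearN /=.
    by have [->] := (superjetP _ _ _ _ _ _).1 uj'.
  (* The approximation was obtained for [\- u_ n]; reflecting the balls of the value and of the jet
     entries turns it into one for [u_ n]. *)
  + move: zz' => [[[[zz' vv'] aa'] pp'] XX'].
    split; [split; [split; [split => //|]|]|]; [|exact: ballN..].
    by rewrite hr_liminfE; have := ballN _ _ _ _ _ vv'; rewrite /= opprK.
  + by move: Fnu; rewrite usc_envelopeE /= mulrN lerNr.
exists nu => //; rewrite usc_envelopeE.
have -> : \- hr_limsup (dom_F Omega I) F_ =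
    hr_liminf (dom_F Omega I) (fun n => \- F_ n).
  by apply/funext => z; rewrite hr_limsupE /= opprK.
by move: Fnu; rewrite /= mulrN lerNr.
Qed.
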